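(* Let $\tau>0$, $\lambda>0$, $\alpha\ge 2$, $\sigma\ge 0$, and consider the system without fading and with tropical interference. Let $(H,X)=(R,R_1)$ at a typical time, or $(H,X)=(H_S,R_S)$ at a typical max-signal epoch, where $H$ is the distance to the serving (nearest) base station and $X$ the distance to the nearest interferer (second nearest base station). Let $\mathcal T=X^{-\alpha}$ and $\mathcal S=H^{-\alpha}/(\sigma^2+\mathcal T)$. Then the coverage probability $p^c(\tau,\lambda,\alpha)=\mathbb P^0(\mathcal S\ge\tau)$ is $$p^c(\tau,\lambda,\alpha)=\mathbb E^0\left[F_{\mathcal T}\!\left(0\vee\left(\frac{H^{-\alpha}}{\tau}-\sigma^2\right)\right)\right],$$ where $F_{\mathcal T}(x)=\mathbb P^0(X^{-\alpha}\le x\mid H)$ is the conditional distribution function of $\mathcal T$ given $H$.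
   Context: Model. Let $\lambda,v>0$. $\Phi=\sum_i\delta_{X_i}$ is a homogeneous Poisson point process of intensity $\lambda$ on $\mathbb R^2$ and $(\Theta_i)$ are i.i.d. uniform angles on $[-\pi,\pi)$, independent of $\Phi$. Base station (BS) $i$ is at $X_i^t=X_i+vt(\cos\Theta_i,\sin\Theta_i)$ at time $t\in\mathbb R$; the user is at the origin; $d_i(t)=\|X_i^t\|$. The serving BS at time $t$ is the nearest one. Palm expectation. For a point process $N$ on the time axis $\mathbb R$ that is a time-shift-compatible function of the moving configuration and has intensity $\lambda_N\in(0,\infty)$, $\mathbb E^0_N[f]=\lambda_N^{-1}\,\mathbb E\big[\sum_{t\in N\cap[0,1]}f_t\big]$, where $f_t$ is the quantity $f$ observed at time $t$. $\mathbb P^0,\mathbb E^0$ denote the Palm probability/expectation of the relevant epoch process. Epochs. Let $T_i$ be the time at which $d_i$ is minimal and $H_i=d_i(T_i)$. - Max-signal epochs: times $s=T_i$ at which BS $i$ is the nearest BS; $H_S=H_i$ and $R_S$ is the distance of the second nearest BS at time $s$. - Typical time: an arbitrary fixed time (with $\mathbb P^0=\mathbb P$); $R$ and $R_1$ are the distances of the nearest and second nearest BS. Noise power is $\sigma^2$; $a\vee b=\max(a,b)$. *)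

(* Defs.v *)
From HB Require Import structures.
From mathcomp Require Import all_boot all_order all_algebra.
From mathcomp Require Import all_classical all_reals all_analysis.

Set Implicit Arguments.
Unset Strict Implicit.
Unset Printing Implicit Defensive.
Import Order.TTheory GRing.Theory Num.Theory.
Import numFieldNormedType.Exports.

Local Open Scope classical_set_scope.
Local Open Scope ring_scope.

Section Independence.
Context {R : realType} {d d1 d2 : measure_display}.
Context {W : measurableType d} (P : probability W R).
Context {T1 : measurableType d1} {T2 : measurableType d2}.

(* Taking [C j = setT] for some of the indices gives the product rule over every
   finite subfamily. *)
Definition mutually_independent (Y : nat -> {RV P >-> T1}) : Prop :=
  forall (n : nat) (C : nat -> set T1), (forall j, measurable (C j)) ->
  P (\bigcap_(j in `I_n) (Y j @^-1` C j)) =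
  (\prod_(j < n) P (Y j @^-1` C j))%E.

(* Independence of the sigma-algebras generated by the two whole families,
   tested on the pi-systems of finite-dimensional rectangles. *)
Definition independent_families
    (Y : nat -> {RV P >-> T1}) (Z : nat -> {RV P >-> T2}) : Prop :=
  forall (n : nat) (B : nat -> set T1) (C : nat -> set T2),
  (forall i, measurable (B i)) -> (forall j, measurable (C j)) ->
  P (\bigcap_(i in `I_n) (Y i @^-1` B i) `&`
     \bigcap_(j in `I_n) (Z j @^-1` C j)) =
  (P (\bigcap_(i in `I_n) (Y i @^-1` B i)) *
   P (\bigcap_(j in `I_n) (Z j @^-1` C j)))%E.

End Independence.

Lemma Npi_lt_pi (R : realType) : - (pi : R) < pi.
Proof. by rewrite gtrN// pi_gt0. Qed.

Lemma geI_card n (A : set nat) (f : nat -> nat) :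
  (forall k, (k < n)%N -> A (f k)) -> {in `I_n &, injective f} -> (`I_n #<= A)%card.
Proof.
move=> fA finj.
rewrite -(card_le_eql (inj_card_eq finj)).
by apply: subset_card_le => _ [k kn <-]; exact: fA.
Qed.

Lemma card_geI1 (A : set nat) : (`I_1 #<= A)%card <-> A !=set0.
Proof.
split=> [/pcard_leP[f]|[i Ai]].
  by exists (f 0%N); apply: (@funS _ _ _ _ f).
by apply: (@geI_card _ _ (fun=> i)) => // -[|x] [|y]; rewrite !inE.
Qed.

Lemma card_geI2 (A : set nat) :
  (`I_2 #<= A)%card <-> exists i j, [/\ i != j, A i & A j].
Proof.
split=> [/pcard_leP[f]|[i [j [ij Ai Aj]]]].
  exists (f 0%N), (f 1%N); split.
  - by apply/eqP => /(@inj _ _ _ f); rewrite !inE /= => /(_ isT isT).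
  - by apply: (@funS _ _ _ _ f).
  - by apply: (@funS _ _ _ _ f).
apply: (@geI_card _ _ (fun n => if n == 0%N then i else j)) => [[]//|].
move=> [|[|x]] [|[|y]]; rewrite !inE //= => _ _ ije.
  by rewrite ije eqxx in ij.
by rewrite ije eqxx in ij.
Qed.

Lemma inf_min_eq (R : realType) (E : set R) (m : R) :
  E m -> lbound E m -> inf E = m.
Proof.
move=> Em mE; apply/eqP; rewrite eq_le; apply/andP; split.
  by apply: ge_inf => //; exists m.
by apply: lb_le_inf => //; exists m.
Qed.

Section Network.
Context {R : realType} {d : measure_display} {W : measurableType d}.
Context (P : probability W R).

Local Notation plane := (measurableTypeR R * measurableTypeR R)%type.

Definition area : set plane -> \bar R :=
  (lebesgue_measure \x lebesgue_measure)%E.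

(* The process is represented by an enumeration of its points; an atom of
   multiplicity m would be listed m times. *)
Definition point_count (X : nat -> {RV P >-> plane}) (w : W) (A : set plane) :
    \bar R :=
  counting [set i | X i w \in A].

Definition poisson_point_process (lambda : R) (X : nat -> {RV P >-> plane}) :
    Prop :=
  (forall (A : set plane) (a : R), measurable A -> area A = a%:E ->
     forall k : nat,
       P [set w | point_count X w A = k%:R%:E] =
       (expR (- (lambda * a)) * (lambda * a) ^+ k / k`!%:R)%:E) /\
  (forall (n : nat) (A : nat -> set plane) (k : nat -> nat),
     (forall j, measurable (A j)) -> (forall j, (area (A j) < +oo)%E) ->
     trivIset setT A ->
     P (\bigcap_(j in `I_n) [set w | point_count X w (A j) = (k j)%:R%:E]) =
     (\prod_(j < n) P [set w | point_count X w (A j) = (k j)%:R%:E])%E).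

(* [uniform_prob] is carried by [-pi, pi]; the endpoint pi has probability 0, so
   this is the uniform law on [-pi, pi). *)
Record mobile_network (lambda : R) (X : nat -> {RV P >-> plane})
    (Theta : nat -> {RV P >-> measurableTypeR R}) : Prop := MobileNetwork {
  network_poisson : poisson_point_process lambda X ;
  network_uniform : forall (i : nat) (A : set (measurableTypeR R)),
    measurable A -> P (Theta i @^-1` A) = uniform_prob (Npi_lt_pi R) A ;
  network_iid : mutually_independent Theta ;
  network_marks : independent_families X Theta }.

Section Kinematics.
Variables (v : R) (X : nat -> {RV P >-> plane})
  (Theta : nat -> {RV P >-> measurableTypeR R}).

Definition bs_position (i : nat) (w : W) (t : R) : R * R :=
  ((X i w).1 + v * t * cos (Theta i w), (X i w).2 + v * t * sin (Theta i w)).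

(* The norm of the library on a product is the sup norm, hence the explicit
   Euclidean formula. *)
Definition bs_dist (i : nat) (w : W) (t : R) : R :=
  Num.sqrt ((bs_position i w t).1 ^+ 2 + (bs_position i w t).2 ^+ 2).

Definition is_nearest (i : nat) (w : W) (t : R) : Prop :=
  forall j, bs_dist i w t <= bs_dist j w t.

(* T_i *)
Definition closest_time (i : nat) (w : W) : R :=
  get [set s | forall t, bs_dist i w s <= bs_dist i w t].

Definition max_signal_epochs (w : W) : set R :=
  [set s | exists i, s = closest_time i w /\ is_nearest i w s].

(* Distance of the (n+1)-st nearest base station, counted with multiplicity: the
   smallest radius of a disc around the user holding n+1 base stations. *)
Definition nth_nearest_dist (n : nat) (w : W) (t : R) : R :=
  inf [set r : R | (`I_n.+1 #<= [set i | bs_dist i w t <= r])%card].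

Definition serving_dist : W -> R -> R := nth_nearest_dist 0.

Definition interferer_dist : W -> R -> R := nth_nearest_dist 1.

Lemma serving_dist_nearest (i : nat) (w : W) (t : R) :
  is_nearest i w t -> serving_dist w t = bs_dist i w t.
Proof.
move=> near_i; apply: inf_min_eq => [|r /card_geI1[j]].
  by apply/card_geI1; exists i => /=.
exact: le_trans (near_i j).
Qed.

Lemma interferer_dist_nearest (i j : nat) (w : W) (t : R) :
  is_nearest i w t -> j != i ->
  (forall k, k != i -> bs_dist j w t <= bs_dist k w t) ->
  interferer_dist w t = bs_dist j w t.
Proof.
move=> near_i ji near_j; apply: inf_min_eq => [|r /card_geI2[k [l [kl]]]].
  by apply/card_geI2; exists j, i; split=> //=; exact: near_i.
have [ki|ki] := eqVneq k i; last by move=> + _; exact: le_trans (near_j k ki).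
by move=> _; apply: le_trans; apply: near_j; rewrite eq_sym -ki.
Qed.

End Kinematics.

(* A quantity observed along the time axis is a function of the sample point and
   of the time of observation. *)

Definition intensity (N : W -> set R) : \bar R :=
  (\int[P]_w counting (N w `&` `[0%R, 1%R]))%E.

Definition palm_expectation (N : W -> set R) (f : W -> R -> \bar R) : \bar R :=
  ((intensity N)^-1 *
   \int[P]_w \esum_(t in N w `&` `[0%R, 1%R]) f w t)%E.

Inductive epoch := TypicalTime of R | MaxSignalEpoch.

Definition expect0 (v : R) (X : nat -> {RV P >-> plane})
    (Theta : nat -> {RV P >-> measurableTypeR R}) (e : epoch)
    (f : W -> R -> \bar R) : \bar R :=
  match e with
  | TypicalTime t => (\int[P]_w f w t)%E
  | MaxSignalEpoch => palm_expectation (max_signal_epochs v X Theta) f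
  end.

(* The probability of the event that the time of observation t lies in [A w]. *)
Definition prob0 (v : R) (X : nat -> {RV P >-> plane})
    (Theta : nat -> {RV P >-> measurableTypeR R}) (e : epoch)
    (A : W -> set R) : \bar R :=
  expect0 v X Theta e (fun w t => (\1_(A w) t)%:E).

(* [F h] is a regular version of the conditional distribution function
   x |-> P0 (Z <= x | H = h): each [F h] is a distribution function, and for every x
   the variable [F H x] satisfies the defining property of P0 (Z <= x | H). *)
Definition conditional_cdf (v : R) (X : nat -> {RV P >-> plane})
    (Theta : nat -> {RV P >-> measurableTypeR R}) (e : epoch)
    (H Z : W -> R -> R) (F : R -> cumulativeBounded (0 : R) (1 : R)) : Prop :=
  forall x : R,
    measurable_fun (setT : set (measurableTypeR R)) (fun h => F h x) /\
    forall B : set (measurableTypeR R), measurable B ->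
      prob0 v X Theta e (fun w => [set t | B (H w t) /\ Z w t <= x]) =
      expect0 v X Theta e (fun w t => (\1_B (H w t) * F (H w t) x)%:E).

Section Coverage.
Variables (v : R) (X : nat -> {RV P >-> plane})
  (Theta : nat -> {RV P >-> measurableTypeR R}) (alpha sigma : R).

Definition tropical_interference (w : W) (t : R) : R :=
  interferer_dist v X Theta w t `^ (- alpha).

Definition sinr (w : W) (t : R) : R :=
  serving_dist v X Theta w t `^ (- alpha) /
  (sigma ^+ 2 + tropical_interference w t).

Definition coverage_probability (e : epoch) (tau : R) : \bar R :=
  prob0 v X Theta e (fun w => [set t | tau <= sinr w t]).

End Coverage.

End Network.

Arguments epoch R : clear implicits.
Arguments TypicalTime {R} _.
Arguments MaxSignalEpoch {R}.

(* Main.v *)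
Require Import Defs.
From HB Require Import structures.
From mathcomp Require Import all_boot all_order all_algebra.
From mathcomp Require Import all_classical all_reals all_analysis.
From mathcomp Require Import measurable_realfun ring lra.
Import Order.TTheory GRing.Theory Num.Theory.
Import numFieldNormedType.Exports.

(** Both kinds of observation, at a fixed time and at a typical max-signal
epoch, are expectations under one sort of object: a Campbell measure [mu] on
sample point x time, normalised by its total mass. For a fixed time [t] it is
the image of [P] under [w |-> (w, t)]; for the max-signal epochs it charges each
pair (w, s) with s an epoch of w between times 0 and 1. The distances [H] of the
serving base station and [X] of the nearest interferer are jointly measurable
functions of (w, t), so the statement becomes one about the finite measure [mu]
and the two random variables [H] and [T = X ^ (-alpha)] on it
([expect0_campbell]). When the total mass is [0] or [+oo], both sides vanish by
the conventions for the inverse.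

On the Campbell measure, coverage [tau <= H ^ (-alpha) / (sigma ^ 2 + T)] is the
event [T <= g H], where [g H] is the maximum of [0] and
[H ^ (-alpha) / tau - sigma ^ 2] ([coverage_level]). The conditional
distribution function is known at deterministic levels and has to be evaluated
at the random level [g H]. This holds first for levels taking countably many
values, by splitting along the values, and then in general by approximating [g]
strictly from above on finer and finer grids: right continuity of the
distribution functions and dominated convergence give the limit
([cdf_measurable_level]).

The rewriting of coverage needs [X > 0]: at [X = 0] also [H = 0], where the
power function takes the value [0], so that there is no coverage although the
level event [T <= g H] holds. Positivity is proved at all times at once, outside
a single null event ([interferer_dist_gt0]). First, almost surely no trajectory
passes through the origin: that would force the initial position to be collinear
with the direction of motion, and given the direction, which is independent of
the position, this confines the position to a line, of area 0
([ae_avoids_origin]). Secondly, almost surely every bounded region contains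
finitely many initial positions ([ae_locally_finite]); as all speeds are [v],
finitely many stations are near the origin at any given time, so the distances
to the origin do not accumulate at 0. *)

Local Open Scope classical_set_scope.
Local Open Scope ring_scope.

(** * A conditional distribution function at a random level *)

Section RandomLevel.
Context {R : realType} (F : R -> cumulativeBounded (0 : R) (1 : R)).
Hypothesis measurable_F : forall x, measurable_fun [set: R] (F ^~ x).

Lemma cumulativeBounded01_ge0 (f : cumulativeBounded (0 : R) (1 : R)) (x : R) :
  0 <= f x.
Proof.
apply: (cvgr_to_le (cumulativeNy f)); near=> y.
by apply: (cumulative_is_nondecreasing f); near: y; exact: nbhs_ninfty_le.
Unshelve. all: by end_near. Qed.

Lemma cumulativeBounded01_le1 (f : cumulativeBounded (0 : R) (1 : R)) (x : R) :
  f x <= 1.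
Proof.
apply: (cvgr_to_ge (cumulativey f)); near=> y.
by apply: (cumulative_is_nondecreasing f); near: y; exact: nbhs_pinfty_ge.
Unshelve. all: by end_near. Qed.

Definition grid_index (g : R -> R) (n : nat) (y : R) : nat :=
  Num.truncn (n.+1%:R * g y).

Definition grid_point (n j : nat) : R := j.+1%:R / n.+1%:R.

(** The first point of the grid of step [1 / n.+1] strictly above [g y]. The
strict inequality lets the approximation enter through the right limits of the
distribution functions, even where [g y] is itself a grid point. *)
Definition grid_level (g : R -> R) (n : nat) (y : R) : R :=
  grid_point n (grid_index g n y).

Lemma grid_level_gt (g : R -> R) n y : g y < grid_level g n y.
Proof. by rewrite ltr_pdivlMr ?ltr0n// mulrC truncnS_gt. Qed.

Lemma grid_level_cvg (g : R -> R) (y : R) :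
  0 <= g y -> grid_level g n y @[n --> \oo] --> g y.
Proof.
move=> g0.
apply: (@squeeze_cvgr _ _ _ _ (cst (g y)) (fun n => g y + n.+1%:R^-1)).
- near=> n; rewrite ltW ?grid_level_gt//=.
  rewrite /grid_level /grid_point -natr1 mulrDl mul1r lerD2r.
  rewrite ler_pdivrMr ?ltr0n// mulrC.
  by rewrite truncn_le mulr_ge0.
- exact: cvg_cst.
- rewrite -[X in _ --> X]addr0.
  by apply: cvgD; [exact: cvg_cst|exact: cvg_harmonic].
Unshelve. all: by end_near. Qed.

Lemma measurable_grid_index (g : R -> R) (n j : nat) :
  measurable_fun setT g -> (forall y, 0 <= g y) ->
  measurable (grid_index g n @^-1` [set j]).
Proof.
move=> mg g0.
have -> : grid_index g n @^-1` [set j] =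
    (fun y => n.+1%:R * g y) @^-1` [set` `[j%:R, j.+1%:R[].
  apply/seteqP; split => y /=; rewrite in_itv/= /grid_index.
    by move/eqP; rewrite truncn_eq// mulr_ge0.
  by move=> ?; apply/eqP; rewrite truncn_eq// mulr_ge0.
by rewrite -[X in measurable X]setTI; apply: measurable_funM.
Qed.

Lemma measurable_countable_level (G : R -> R -> R) (a : nat -> R)
    (k : R -> nat) :
  (forall x, measurable_fun setT (G ^~ x)) ->
  (forall j, measurable (k @^-1` [set j])) ->
  measurable_fun setT (fun y => G y (a (k y))).
Proof.
move=> mG mk.
rewrite (_ : setT = \bigcup_j (k @^-1` [set j])); last first.
  by apply/seteqP; split => // y _; exists (k y).
apply/measurable_fun_bigcup => //= j.
apply: (eq_measurable_fun (G ^~ (a j))); first by move=> y /set_mem /= ->.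
by apply: measurable_funTS; exact: mG.
Qed.

Lemma cdf_grid_level_cvg (g : R -> R) (y : R) :
  0 <= g y -> F y (grid_level g n y) @[n --> \oo] --> (F y (g y) : R).
Proof.
move=> g0.
apply: (@cvg_comp _ _ _ (grid_level g ^~ y) (F y) _ (at_right (g y))).
  move=> A /(grid_level_cvg _ _ g0) Ag.
  have : \forall n \near \oo, g y < grid_level g n y -> A (grid_level g n y).
    exact: Ag.
  by apply: filterS => n; apply; exact: grid_level_gt.
exact: cumulative_is_right_continuous.
Qed.

Lemma measurable_cdf_level (g : R -> R) :
  measurable_fun setT g -> (forall y, 0 <= g y) ->
  measurable_fun [set: R] (fun y => F y (g y)).
Proof.
move=> mg g0; apply/measurable_EFinP.
apply: (emeasurable_fun_cvg (fun n y => (F y (grid_level g n y))%:E)).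
  move=> n; apply/measurable_EFinP.
  apply: (measurable_countable_level F (grid_point n)) => // j.
  exact: measurable_grid_index.
by move=> y _; apply: cvg_EFin; [exact: nearW|exact: cdf_grid_level_cvg].
Qed.

Context {d} {T : measurableType d} (mu : {measure set T -> \bar R}).
Hypothesis mu_fin : (mu setT < +oo)%E.
Variables h z : T -> R.
Hypotheses (mh : measurable_fun [set: T] h) (mz : measurable_fun [set: T] z).
Hypothesis F_cdf : forall (x : R) (B : set R), measurable B ->
  mu [set t | B (h t) /\ z t <= x] =
  (\int[mu]_t (\1_B (h t) * F (h t) x)%:E)%E.

(** A level taking countably many values: on the event that [h] selects the
[j]-th value, the level is deterministic and the defining property of [F]
applies. *)
Lemma cdf_countable_level (a : nat -> R) (k : R -> nat) :
  (forall j, measurable (k @^-1` [set j])) ->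
  mu [set t | z t <= a (k (h t))] = (\int[mu]_t (F (h t) (a (k (h t))))%:E)%E.
Proof.
move=> mk.
pose D j := [set t | k (h t) = j].
have mD j : measurable (D j).
  by rewrite -[D j]setTI; apply: (mh measurableT _ (mk j)).
have tD : trivIset setT D by move=> i j _ _ [t [<- <-]].
have UD : \bigcup_j D j = setT.
  by apply/seteqP; split => // t _; exists (k (h t)).
have mf : measurable_fun [set: T]
    (fun t => (F (h t) (a (k (h t))))%:E : \bar R).
  apply/measurable_EFinP.
  have mFk := measurable_countable_level F a _ measurable_F mk.
  exact: measurableT_comp mFk mh.
have mG j : measurable (D j `&` [set t | z t <= a j]).
  apply: measurableI => //; rewrite -[X in measurable X]setTI.
  exact: (mz measurableT _ (measurable_itv `]-oo, (a j)])).
have -> : [set t | z t <= a (k (h t))] =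
    \bigcup_j (D j `&` [set t | z t <= a j]).
  by apply/seteqP; split => [t ?|t [j _ [<-]//]]; exists (k (h t)).
rewrite -UD ge0_integral_bigcup//; last 2 first.
  by rewrite UD.
  by move=> t _; rewrite lee_fin cumulativeBounded01_ge0.
rewrite measure_bigcup//; last by apply: trivIset_setIr.
rewrite (@eq_eseriesl _ _ xpredT); last by move=> j; rewrite in_setT.
apply: eq_eseriesr => j _.
rewrite -[X in mu X]/([set t | (k @^-1` [set j]) (h t) /\ z t <= a j]).
rewrite F_cdf// [RHS]integral_mkcond; apply: eq_integral => t _.
rewrite /= patchE indicE.
case: (boolP (t \in D j)) => tD1; move: (tD1).
  by rewrite inE /D /= => kh; rewrite mem_set//= mul1r kh.
by rewrite notin_setE => nkh; rewrite memNset ?mul0r.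
Qed.

(** The substitution rule [P (Z <= g H) = E (F H (g H))]. Both sides pass to the
limit along the grid levels: the indicators converge because the levels stay
above [g H] and tend to it, the integrands converge because each [F y] is right
continuous, and everything is bounded by 1 on a finite measure space. *)
Lemma cdf_measurable_level (g : R -> R) :
  measurable_fun setT g -> (forall y, 0 <= g y) ->
  mu [set t | z t <= g (h t)] = (\int[mu]_t (F (h t) (g (h t)))%:E)%E.
Proof.
move=> mg g0.
have int1 : mu.-integrable setT (cst 1%E : T -> \bar R).
  apply/integrableP; split => //.
  by under eq_integral do rewrite abse1; rewrite integral_cst//= mul1e.
have mS (q : R -> R) : measurable_fun setT q ->
    measurable [set t | z t <= q (h t)].
  move=> mq; rewrite -[X in measurable X]setTI.
  apply: (@measurable_fun_ler _ _ _ setT z (q \o h)) => //.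
  exact: measurableT_comp mq mh.
have mgrid n : measurable_fun setT (grid_level g n).
  apply: (measurable_countable_level (fun=> id) (grid_point n)) => // j.
  exact: measurable_grid_index.
have mcdf q : measurable_fun setT (fun y => F y (q y)) ->
    measurable_fun setT (fun t => (F (h t) (q (h t)))%:E : \bar R).
  by move=> mq; apply/measurable_EFinP; exact: measurableT_comp mq mh.
have gridE n : mu [set t | z t <= grid_level g n (h t)] =
    (\int[mu]_t (F (h t) (grid_level g n (h t)))%:E)%E.
  apply: (cdf_countable_level (grid_point n) (grid_index g n)) => j.
  exact: measurable_grid_index.
have cvgF : (\int[mu]_t (F (h t) (grid_level g n (h t)))%:E)%E @[n --> \oo] -->
    (\int[mu]_t (F (h t) (g (h t)))%:E)%E.
  apply: (@dominated_cvg _ _ _ mu _ measurableT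
    (fun n t => (F (h t) (grid_level g n (h t)))%:E)
    (fun t => (F (h t) (g (h t)))%:E) (cst 1%E)) => //.
  - move=> n; apply: mcdf.
    apply: (measurable_countable_level F (grid_point n)) => // j.
    exact: measurable_grid_index.
  - move=> t _; apply: cvg_EFin; [exact: nearW|exact: cdf_grid_level_cvg].
  - move=> n t _; rewrite /= lee_fin.
    by rewrite ger0_norm ?cumulativeBounded01_ge0// cumulativeBounded01_le1.
pose S (q : R -> R) := [set t | z t <= q (h t)].
have cvgS : (\int[mu]_t (\1_(S (grid_level g n)) t)%:E)%E @[n --> \oo] -->
    (\int[mu]_t (\1_(S g) t)%:E)%E.
  apply: (@dominated_cvg _ _ _ mu _ measurableT
    (fun n t => (\1_(S (grid_level g n)) t)%:E)
    (fun t => (\1_(S g) t)%:E) (cst 1%E)) => //.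
  - by move=> n; apply/measurable_EFinP/measurable_indic; exact: mS.
  - move=> t _; apply: cvg_near_cst.
    have [zg|gz] := leP (z t) (g (h t)).
      apply: nearW => n; rewrite !indicE !mem_set//=.
      by rewrite /S /= (le_trans zg)// ltW// grid_level_gt.
    near=> n; rewrite !indicE !memNset//=; apply/negP; rewrite -ltNge//.
    near: n; exact: (cvgr_lt _ (grid_level_cvg _ _ (g0 _)) _ gz).
  - by move=> n t _; rewrite /= lee_fin ger0_norm// indicE; case: (_ \in _).
rewrite -[X in mu X]setIT -integral_indic//; last exact: mS.
apply/esym; apply: cvg_unique cvgF _ => //.
rewrite (_ : (fun n => _) =
  (fun n => \int[mu]_t (\1_(S (grid_level g n)) t)%:E)%E)//.
apply/funext => n; rewrite -gridE integral_indic ?setIT//; exact: mS.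
Unshelve. all: by end_near. Qed.

End RandomLevel.

(** * The Campbell measure of a labelled process of epochs *)

Section CampbellMeasure.
Context {R : realType} {d : measure_display} {T : measurableType d}.

(** For an infinite set both sides are [+oo]: a sum of ones over finite subsets
is their cardinal, and the set contains finite subsets of any size. *)
Lemma counting_esum (S : choiceType) (A : set S) :
  counting A = \esum_(t in A) (1%E : \bar R).
Proof.
have iter_add1 k : iter k (+%E 1%E) 0%E = k%:R%:E :> \bar R.
  by elim: k => //= k ->; rewrite -EFinD -natr1 addrC.
rewrite /counting; case: asboolP => [finA|infA].
  rewrite esum_fset// fsbig_finite//= big_const_seq count_predT.
  by rewrite iter_add1.
apply/esym/eq_infty => r.
have [B BA rB] := infinite_set_fset (Num.truncn r).+1 infA.
apply: esum_ge; eexists; first by split; [|exact: BA]; exact: finite_fset.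
rewrite fsbig_finite//= set_fsetK big_const_seq count_predT.
by rewrite iter_add1 lee_fin (le_trans (ltW (truncnS_gt r)))// ler_nat.
Qed.

(** The restricted measure does not charge the complement of [D], and agrees
with [mu] on the measurable subsets of [D]. *)
Lemma ge0_integral_mrestr (mu : {measure set T -> \bar R}) (D : set T)
    (mD : measurable D) (f : T -> \bar R) :
  measurable_fun setT f -> (forall x, 0 <= f x)%E ->
  (\int[mrestr mu mD]_x f x = \int[mu]_(x in D) f x)%E.
Proof.
move=> mf f0.
rewrite [LHS](ge0_negligible_integral (measurableC mD))//; last first.
  by rewrite /= /mrestr setICl measure0.
rewrite setTD setCK; apply: eq_measure_integral => A mA AD.
by rewrite /= /mrestr setIidl.
Qed.

Variables (P : {measure set T -> \bar R}) (tau : nat -> T -> R)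
  (G : nat -> set T).
Hypotheses (mtau : forall i, measurable_fun setT (tau i))
  (mG : forall i, measurable (G i)).

Definition labelled_epochs (w : T) : set R :=
  [set s | exists i, s = tau i w /\ G i w].

(** An epoch may carry several labels but counts once in a sum over epochs; it
is attributed to its least label. *)
Definition first_label (i : nat) : set T :=
  (G i `&` [set w | tau i w \in `[0, 1]]) `\`
    \bigcup_(j in `I_i) (G j `&` [set w | tau j w == tau i w]).

Lemma measurable_first_label i : measurable (first_label i).
Proof.
apply: measurableD; first apply: measurableI => //.
  rewrite -[X in measurable X]setTI.
  exact: (mtau i measurableT _ (measurable_itv `[0, 1])).
apply: bigcup_measurable => j _; apply: measurableI => //.
rewrite -[X in measurable X]setTI.
by apply: measurable_fun_eqr.
Qed.

Lemma labelled_epochsE w :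
  labelled_epochs w `&` `[0, 1]%classic = tau ^~ w @` [set i | first_label i w].
Proof.
apply/seteqP; split=> [s [[i [-> Gi]] /= s01]|_ [i [[Gi ti] _] <-]]; last first.
  by split => //; exists i.
have ex : exists j, `[< G j w >] && (tau j w == tau i w).
  by exists i; rewrite eqxx andbT; apply/asboolP.
case: (ex_minnP ex) => j /andP[/asboolP Gj /eqP tji] jmin; exists j => //.
split; first by split => //=; rewrite tji.
move=> [k /= kj [Gk /eqP tk]].
(* A smaller label [k] of the same epoch would contradict the choice of [j]. *)
have := jmin k; rewrite tk tji eqxx andbT leqNgt kj => jm.
by have : false by apply: jm; apply/asboolP.
Qed.

Lemma first_label_inj w : set_inj [set i | first_label i w] (tau ^~ w).
Proof.
move=> i j; rewrite !inE => -[[Gi _] Fi] [[Gj _] Fj] tij.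
apply/eqP; case: (ltngtP i j) => // ij; exfalso.
  by apply: Fj; exists i => //; split => //=; rewrite tij.
by apply: Fi; exists j => //; split => //=; rewrite tij.
Qed.

Lemma esum_labelled_epochs w (f : R -> \bar R) : (forall s, 0 <= f s)%E ->
  (\esum_(s in labelled_epochs w `&` `[0%R, 1%R]) f s =
   \sum_(i <oo) ((fun w' => f (tau i w)) \_ (first_label i)) w)%E.
Proof.
move=> f0; rewrite labelled_epochsE esum_image; last exact: first_label_inj.
rewrite esum_mkcond nneseries_esumT; last first.
  by move=> i; rewrite patchE; case: ifP.
by apply: eq_esum => i _; rewrite patchE; congr (if _ then _ else _).
Qed.

(** Attributing epochs to their least labels turns a sum over the random set of
epochs into a series over labels. The mean of the [i]-th term is an integral
against the image, under [w |-> (w, tau i w)], of [P] restricted to the event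
that [i] is the least label of an epoch in the unit interval; the sum of these
images is the measure sought. The second property transports null events of [P]
to all epochs at once. *)
Lemma campbell_measure_exists : exists mu : {measure set (T * R) -> \bar R},
  (forall f : T * R -> \bar R,
     measurable_fun setT f -> (forall p, 0 <= f p)%E ->
     (\int[P]_w (\esum_(s in labelled_epochs w `&` `[0%R, 1%R]) f (w, s)) =
      \int[mu]_p f p)%E) /\
  (forall N, measurable N -> P N = 0%E -> mu (N `*` setT) = 0%E).
Proof.
have mpair i : measurable_fun setT (fun w => (w, tau i w)).
  exact: measurable_fun_pair.
pose m i : {measure set (T * R) -> \bar R} :=
  measure_function_pushforward__canonical__measure_function_Measure
    (mrestr P (measurable_first_label i)) (mpair i).
have mcomp (f : T * R -> \bar R) i : measurable_fun setT f ->
    measurable_fun setT (fun w => f (w, tau i w)).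
  by move=> mf; exact: measurableT_comp mf (mpair i).
exists (mseries m 0); split=> [f mf f0|N mN PN0]; last first.
  rewrite /= /mseries eseries0// => i _ _; rewrite /m /= /pushforward /mrestr.
  apply/eqP; rewrite -measure_le0 -PN0; apply: le_measure; rewrite ?inE//.
    apply: measurableI; last exact: measurable_first_label.
    rewrite -[X in measurable X]setTI.
    exact: (mpair i measurableT _ (measurableX mN measurableT)).
  by move=> w [[]].
rewrite ge0_integral_measure_series//.
under eq_integral do rewrite (esum_labelled_epochs _ (fun s => f (_, s)))//.
rewrite integral_nneseries//; last 2 first.
- move=> i; apply/(measurable_restrictT _ (measurable_first_label i)).
  exact: measurable_funTS (mcomp _ _ mf).
- by move=> i w _; rewrite patchE; case: ifP.
apply: eq_eseriesr => i _; rewrite -integral_mkcond.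
rewrite [RHS]ge0_integral_pushforward//.
by rewrite ge0_integral_mrestr//; [exact: (mcomp f i mf)|move=> w /=].
Qed.

End CampbellMeasure.

(** * Almost sure properties of the moving configuration *)

Section AlmostSure.
Context {R : realType}.

Lemma product_measure12E d1 d2
    (T1 : measurableType d1) (T2 : measurableType d2)
    (m1 : {sigma_finite_measure set T1 -> \bar R})
    (m2 : {sigma_finite_measure set T2 -> \bar R}) (A : set (T1 * T2)) :
  measurable A -> (m1 \x m2)%E A = (m1 \x^ m2)%E A.
Proof.
by apply: product_measure_unique => B C mB mC; exact: product_measure2E.
Qed.

Local Notation plane := (measurableTypeR R * measurableTypeR R)%type.

Lemma measurable_line (a b : R) :
  measurable [set x : plane | a * x.1 = b * x.2].
Proof.
have m1 : measurable_fun [set: plane] (fun x => a * x.1 : R).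
  by apply: measurable_funM => //; exact: measurable_fst.
have m2 : measurable_fun [set: plane] (fun x => b * x.2 : R).
  by apply: measurable_funM => //; exact: measurable_snd.
rewrite -[X in measurable X]setTI.
rewrite (_ : [set x : plane | _] =
  (fun x : plane => a * x.1 == b * x.2) @^-1` [set true]).
  exact: (measurable_fun_eqr m1 m2).
by apply/seteqP; split => x /= /eqP.
Qed.

(** The sections of the line in the direction of a coordinate with a nonzero
coefficient are singletons. *)
Lemma area_line (a b : R) : (a != 0) || (b != 0) ->
  area [set x : plane | a * x.1 = b * x.2] = 0%E.
Proof.
have ml := measurable_line a b.
case/orP => [a0|b0].
  rewrite /area product_measure12E// /product_measure2.
  apply: integral0_eq => y _ /=.
  rewrite (_ : ysection _ _ = [set b * y / a]) ?lebesgue_measure_set1//.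
  apply/seteqP; split => x; rewrite ysectionE /=; last by move=> ->; field.
  by move=> /(congr1 ( *%R^~ a^-1)) <-; field.
rewrite /area /product_measure1; apply: integral0_eq => x _ /=.
rewrite (_ : xsection _ _ = [set a * x / b]) ?lebesgue_measure_set1//.
apply/seteqP; split => y; rewrite xsectionE /=; last by move=> ->; field.
by move=> /(congr1 ( *%R^~ b^-1)) ->; field.
Qed.

Context {d : measure_display} {W : measurableType d} (P : probability W R).
Variables (lambda : R) (X : nat -> {RV P >-> plane}).
Hypothesis X_poisson : poisson_point_process lambda X.

Lemma point_countE (A : set plane) (w : W) :
  point_count X w A = (\sum_(n <oo) (\1_A (X n w))%:E)%E.
Proof.
rewrite /point_count counting_dirac; apply: eq_eseriesr => n _.
rewrite /dirac; congr (_%:E); rewrite !indicE; congr ((_ : bool)%:R).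
by apply/idP/idP; rewrite !inE /= inE.
Qed.

Lemma measurable_point_count (A : set plane) : measurable A ->
  measurable_fun setT (fun w => point_count X w A).
Proof.
move=> mA; under eq_fun do rewrite point_countE.
apply: ge0_emeasurable_sum => [n w _ _|n _]; first by rewrite lee_fin.
apply/measurable_EFinP.
exact: (measurableT_comp (measurable_indic mA) (measurable_funPT (X n))).
Qed.

Lemma measurable_point_count_eq (A : set plane) (k : \bar R) : measurable A ->
  measurable [set w | point_count X w A = k].
Proof.
move=> mA; rewrite -[X in measurable X]setTI.
by apply: (measurable_point_count _ mA measurableT [set k]).
Qed.

(** The law of each single point is absolutely continuous: a region of area 0
almost surely contains no point of the process. *)
Lemma point_prob_null (A : set plane) (i : nat) :
  measurable A -> area A = 0%E -> P (X i @^-1` A) = 0%E.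
Proof.
move=> mA A0.
have mX : measurable (X i @^-1` A).
  by rewrite -[X in measurable X]setTI; exact: measurable_funP.
have P1 := X_poisson.1 A 0 mA A0 0%N.
rewrite mulr0 oppr0 expR0 expr0 fact0 invr1 !mulr1 in P1.
apply/eqP; rewrite eq_le measure_ge0 andbT.
have <- : P (~` [set w | point_count X w A = 0%E]) = 0%E.
  rewrite probability_setC ?P1 ?subee//.
  exact: measurable_point_count_eq.
apply: le_measure; rewrite ?inE//.
  exact/measurableC/measurable_point_count_eq.
move=> w /= Aw; apply/eqP.
rewrite point_countE (nneseriesD1 (n := i)) => [|k _|//]; last first.
  by rewrite lee_fin.
rewrite padde_eq0 ?lee_fin//; last first.
  by apply: nneseries_ge0 => k _ _; rewrite lee_fin.
by rewrite indicE mem_set// eqe oner_eq0.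
Qed.

(** The Poisson weights sum to 1, which leaves no mass for an infinite count. *)
Lemma ae_point_count_fin (A : set plane) (a : R) : 0 < lambda ->
  measurable A -> 0 < a -> area A = a%:E ->
  {ae P, forall w, (point_count X w A < +oo)%E}.
Proof.
move=> l0 mA a0 Aa.
pose B k := [set w | point_count X w A = k%:R%:E].
have mB k : measurable (B k) by exact: measurable_point_count_eq.
have tB : trivIset setT B.
  move=> i j _ _ [w [Bi Bj]]; apply/eqP.
  by rewrite -(eqr_nat R) -(inj_eq (@EFin_inj R)) -Bi -Bj.
have P1 : P (\bigcup_k B k) = 1%E.
  rewrite measure_bigcup// (@eq_eseriesl _ _ xpredT); last first.
    by move=> j; rewrite in_setT.
  rewrite -(@probability_setT _ _ _ (poisson_prob (lambda * a) 0)).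
  rewrite /= /poisson_prob mulr_gt0// -nneseries_esumT; last first.
    by move=> k; rewrite lee_fin poisson_pmf_ge0.
  apply: eq_eseriesr => k _; rewrite (proj1 X_poisson _ _ mA Aa).
  by rewrite /poisson_pmf mulr_gt0//; congr (_%:E); ring.
exists (~` \bigcup_k B k); split.
- by apply: measurableC; exact: bigcup_measurable.
- by rewrite probability_setC ?P1 ?subee//; exact: bigcup_measurable.
- move=> w /= cinf [k _ Bk]; apply: cinf; rewrite Bk; exact: ltry.
Qed.

Definition centered_box (n : nat) : set plane :=
  `[- n.+1%:R, n.+1%:R]%classic `*` `[- n.+1%:R, n.+1%:R]%classic.

Lemma area_centered_box n : area (centered_box n) = ((2 * n.+1%:R) ^+ 2)%:E.
Proof.
rewrite /area /centered_box product_measure1E//=.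
have n0 : (0 : R) < n.+1%:R by rewrite ltr0n.
rewrite lebesgue_measure_itv/= lte_fin ifT; last by lra.
by rewrite -EFinD -EFinM; congr (_%:E); ring.
Qed.

Definition locally_finite (w : W) : Prop :=
  forall n, finite_set [set i | centered_box n (X i w)].

Lemma ae_locally_finite : 0 < lambda -> {ae P, forall w, locally_finite w}.
Proof.
move=> l0; apply/ae_foralln => n.
have n0 : (0 : R) < n.+1%:R by rewrite ltr0n.
have mbox : measurable (centered_box n) by exact: measurableX.
have box0 : 0 < (2 * n.+1%:R : R) ^+ 2 by rewrite exprn_gt0 ?mulr_gt0.
have := ae_point_count_fin _ _ l0 mbox box0 (area_centered_box n).
apply: filterS => w; rewrite /point_count /counting.
case: asboolP => // + _.
by under eq_set do rewrite inE.
Qed.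

Context (Theta : nat -> {RV P >-> measurableTypeR R}).
Hypothesis network_marks : independent_families X Theta.

(** Independence makes the joint law of position and direction a product; the
right-hand side is its disintegration over the direction. *)
Lemma joint_law (i : nat) (N : set (plane * measurableTypeR R)) :
  measurable N ->
  P [set w | N (X i w, Theta i w)] =
  (\int[distribution P (Theta i)]_y distribution P (X i) (ysection N y))%E.
Proof.
move=> mN.
have mXT : measurable_fun setT (fun w => (X i w, Theta i w)).
  by apply: measurable_fun_pair.
pose XT : {mfun W >-> (plane * measurableTypeR R)%type} :=
  HB.pack (fun w => (X i w, Theta i w)) (isMeasurableFun.Build _ _ _ _ _ mXT).
transitivity ((distribution P (X i) \x distribution P (Theta i))%E N);
  last by rewrite product_measure12E.
rewrite (product_measure_unique (m' := distribution P XT))// => B C mB mC.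
(* The product rule for whole families is used with a test set at [i] only. *)
pose at_i (T' : Type) (D : set T') (k : nat) := if k == i then D else setT.
have at_iE d' (T' : measurableType d') (Y : nat -> {RV P >-> T'}) (D : set T') :
    \bigcap_(k in `I_i.+1) (Y k @^-1` at_i T' D k) = Y i @^-1` D.
  apply/seteqP; split => [w /(_ i (ltnSn i))|w Dw k _]; rewrite /at_i ?eqxx//=.
  by case: eqP => [->|].
have m_at_i d' (T' : measurableType d') (D : set T') k :
    measurable D -> measurable (at_i T' D k).
  by rewrite /at_i; case: eqP.
have := network_marks i.+1 (at_i _ B) (at_i _ C)
  (fun k => m_at_i _ _ _ k mB) (fun k => m_at_i _ _ _ k mC).
by rewrite !at_iE.
Qed.

(** No initial position is collinear with its direction of motion, that is, no
trajectory passes through the origin. *)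
Definition avoids_origin (w : W) : Prop :=
  forall i, sin (Theta i w) * (X i w).1 <> cos (Theta i w) * (X i w).2.

(** Given the direction, an initial position whose trajectory meets the origin
lies on a line, which is almost surely free of points. *)
Lemma ae_avoids_origin : {ae P, forall w, avoids_origin w}.
Proof.
apply/ae_foralln => i.
pose N : set (plane * measurableTypeR R) :=
  [set p | sin p.2 * p.1.1 = cos p.2 * p.1.2].
have mN : measurable N.
  have mtrig (f : R -> R) (c : plane -> measurableTypeR R) :
      continuous f -> measurable_fun setT c ->
      measurable_fun setT
        (fun p : plane * measurableTypeR R => f p.2 * c p.1).
    move=> cf mc; apply: measurable_funM.
      exact: measurableT_comp (continuous_measurable_fun cf) measurable_snd.
    exact: measurableT_comp mc measurable_fst.
  rewrite -[X in measurable X]setTI.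
  rewrite (_ : N =
    (fun p => sin p.2 * p.1.1 == cos p.2 * p.1.2) @^-1` [set true]).
    apply: (measurable_fun_eqr (mtrig _ fst _ _) (mtrig _ snd _ _)) => //.
    + exact: continuous_sin.
    + exact: continuous_cos.
  by apply/seteqP; split => p /eqP.
exists [set w | N (X i w, Theta i w)]; split.
- rewrite -[X in measurable X]setTI.
  have mXT : measurable_fun setT (fun w => (X i w, Theta i w)).
    exact: measurable_fun_pair.
  exact: mXT.
- transitivity (P [set w | N (X i w, Theta i w)]); first by [].
  rewrite (joint_law i _ mN); apply: integral0_eq => y _ /=.
  rewrite ysectionE.
  apply: (point_prob_null [set x | sin y * x.1 = cos y * x.2]).
    exact: measurable_line.
  apply: area_line; rewrite -negb_and; apply/negP => /andP[/eqP s0 /eqP c0].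
  have := cos2Dsin2 y; rewrite s0 c0 expr0n addr0 => /esym/eqP.
  by rewrite oner_eq0.
- by move=> w /contrapT.
Qed.

End AlmostSure.

(** * Distances along the trajectories *)

Section Kinematics.
Context {R : realType} {d : measure_display} {W : measurableType d}.
Context (P : probability W R).

Local Notation plane := (measurableTypeR R * measurableTypeR R)%type.

Variables (v : R) (X : nat -> {RV P >-> plane})
  (Theta : nat -> {RV P >-> measurableTypeR R}).

Local Notation dist := (bs_dist v X Theta).
Local Notation serving := (serving_dist v X Theta).
Local Notation interferer := (interferer_dist v X Theta).

Lemma bs_dist_ge0 i w t : 0 <= dist i w t.
Proof. exact: sqrtr_ge0. Qed.

Lemma serving_dist_lt w t r :
  serving w t < r <-> exists i, dist i w t < r.
Proof.
rewrite /serving_dist /nth_nearest_dist; set E := [set r | _].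
have E0 : E !=set0 by exists (dist 0%N w t); apply/card_geI1; exists 0%N => /=.
have lbE : has_lbound E.
  by exists 0 => x /card_geI1[i]; apply: le_trans; exact: bs_dist_ge0.
split=> [/(inf_lt E0)[q /card_geI1[i /= iq] qr]|[i ir]].
  by exists i; exact: le_lt_trans qr.
apply: le_lt_trans ir; apply: ge_inf => //; apply/card_geI1.
by exists i => /=; exact: lexx.
Qed.

Lemma interferer_dist_lt w t r :
  interferer w t < r <->
  exists i j, [/\ i != j, dist i w t < r & dist j w t < r].
Proof.
rewrite /interferer_dist /nth_nearest_dist; set E := [set r | _].
have E0 : E !=set0.
  exists (Num.max (dist 0%N w t) (dist 1%N w t)).
  apply/card_geI2; exists 0%N, 1%N.
  by split; rewrite //= le_max lexx ?orbT.
have lbE : has_lbound E.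
  exists 0 => x /card_geI2[i [j [_ + _]]].
  by apply: le_trans; exact: bs_dist_ge0.
split=> [|[i [j [ij ir jr]]]].
  move=> /(inf_lt E0)[q /card_geI2[i [j /= [ij iq jq] qr]]].
  by exists i, j; split => //; exact: le_lt_trans qr.
apply: (@le_lt_trans _ _ (Num.max (dist i w t) (dist j w t))).
  apply: ge_inf => //; apply/card_geI2; exists i, j.
  by split; rewrite //= le_max lexx ?orbT.
by rewrite gt_max ir.
Qed.

Lemma bs_dist_gt0 i w t : avoids_origin P X Theta w -> 0 < dist i w t.
Proof.
move=> /(_ i) aw; rewrite lt_neqAle bs_dist_ge0 andbT eq_sym.
rewrite /bs_dist sqrtr_eq0 -ltNge lt_neqAle addr_ge0 ?sqr_ge0// andbT eq_sym.
rewrite paddr_eq0 ?sqr_ge0// !sqrf_eq0; apply/negP => /andP[/eqP + /eqP].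
rewrite /bs_position /= => /eqP + /eqP; rewrite !addr_eq0 => /eqP x1 /eqP x2.
by apply: aw; rewrite x1 x2; ring.
Qed.

(** A station within distance 1 of the origin at time [t] started within
[1 + v * |t|] of it. *)
Lemma finitely_many_close_bs w t : 0 < v -> locally_finite P X w ->
  finite_set [set i | dist i w t <= 1].
Proof.
move=> v0 lf.
pose n := Num.truncn (1 + v * `|t|).
apply: sub_finite_set (lf n) => i /= d1.
have nt : 1 + v * `|t| <= n.+1%:R by rewrite ltW// truncnS_gt.
have coord (x u : R) : `|u| <= 1 -> `|x + v * t * u| <= 1 ->
    x \in `[- n.+1%:R, n.+1%:R].
  move=> u1 xu1; rewrite in_itv /= -ler_norml (le_trans _ nt)//.
  rewrite -(addrK (v * t * u) x) (le_trans (ler_normB _ _))// lerD//.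
  rewrite !normrM gtr0_norm// ler_piMr//.
  by rewrite mulr_ge0// ltW.
have sq x y : Num.sqrt (x ^+ 2 + y ^+ 2 : R) <= 1 -> `|x| <= 1.
  apply: le_trans; rewrite -sqrtr_sqr.
  by rewrite ler_sqrt ?addr_ge0 ?sqr_ge0// lerDl sqr_ge0.
split; rewrite /=.
  apply: (coord _ (cos (Theta i w))); last exact: sq d1.
  by rewrite ler_norml cos_geN1 cos_le1.
apply: (coord _ (sin (Theta i w))); last first.
  by apply: (sq _ (bs_position v X Theta i w t).1); rewrite addrC.
by rewrite ler_norml sin_geN1 sin_le1.
Qed.

(** Finitely many stations are within distance 1, each at a positive distance,
so all distances have a common positive lower bound. *)
Lemma interferer_dist_gt0 w t :
  0 < v -> locally_finite P X w -> avoids_origin P X Theta w ->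
  0 < interferer w t.
Proof.
move=> v0 lf av.
have min_gt0 (s : seq nat) :
    exists2 e, 0 < e <= 1 & forall i, i \in s -> e <= dist i w t.
  elim: s => [|i s [e /andP[e0 e1] es]].
    by exists 1; rewrite ?ltr01 ?lexx.
  exists (Num.min e (dist i w t)).
    by rewrite lt_min e0 bs_dist_gt0//= ge_min e1.
  move=> j; rewrite inE => /orP[/eqP ->|/es ej]; rewrite ge_min ?lexx ?orbT//.
  by rewrite ej.
have [s sE] := (finite_seqP _).1 (finitely_many_close_bs w t v0 lf).
have [e /andP[e0 e1] es] := min_gt0 s.
apply: (lt_le_trans e0); rewrite leNgt; apply/negP.
move=> /interferer_dist_lt[i [_ [_ + _]]]; apply/negP; rewrite -leNgt.
have [/ltW|i1] := ltP 1 (dist i w t).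
  exact: le_trans.
by apply: es; move: i1; rewrite -/([set i | dist i w t <= 1] i) sE.
Qed.

Let spacetime_fst i : measurable_fun setT (fun p : W * R => X i p.1).
Proof. exact: measurableT_comp (measurable_funPT (X i)) measurable_fst. Qed.

Lemma measurable_bs_dist i :
  measurable_fun setT (fun p : W * R => dist i p.1 p.2).
Proof.
have mTheta : measurable_fun setT (fun p : W * R => Theta i p.1 : R).
  exact: measurableT_comp (measurable_funPT (Theta i)) measurable_fst.
have coord (c : W * R -> R) (f : R -> R) :
    continuous f -> measurable_fun setT c ->
    measurable_fun setT
      (fun p : W * R => (c p + v * p.2 * f (Theta i p.1)) ^+ 2).
  move=> cf mc; apply: measurable_funX; apply: measurable_funD => //.
  apply: measurable_funM.
    by apply: measurable_funM => //; exact: measurable_snd.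
  exact: measurableT_comp (continuous_measurable_fun cf) mTheta.
apply: (measurableT_comp (continuous_measurable_fun (@sqrt_continuous R))).
apply: measurable_funD.
  apply: (coord _ cos); first exact: continuous_cos.
  exact: measurableT_comp measurable_fst (spacetime_fst i).
apply: (coord _ sin); first exact: continuous_sin.
exact: measurableT_comp measurable_snd (spacetime_fst i).
Qed.

Lemma measurable_serving_dist :
  measurable_fun setT (fun p : W * R => serving p.1 p.2).
Proof.
apply: (measurability _ (RGenInftyO.measurableE R)) => _ [_ [r ->] <-].
rewrite (_ : _ @^-1` _ = \bigcup_i [set p : W * R | dist i p.1 p.2 < r]).
  rewrite setTI; apply: bigcup_measurable => i _.
  rewrite -[X in measurable X]setTI; apply: measurable_fun_ltr => //.
  exact: measurable_bs_dist.
apply/seteqP; split => p /=; rewrite in_itv/= serving_dist_lt.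
  by case=> i ir; exists i.
by case=> i _ ir; exists i.
Qed.

Lemma measurable_interferer_dist :
  measurable_fun setT (fun p : W * R => interferer p.1 p.2).
Proof.
apply: (measurability _ (RGenInftyO.measurableE R)) => _ [_ [r ->] <-].
rewrite (_ : _ @^-1` _ = \bigcup_i \bigcup_(j in [set j | i != j])
    ([set p : W * R | dist i p.1 p.2 < r] `&`
     [set p : W * R | dist j p.1 p.2 < r])).
  rewrite setTI; apply: bigcup_measurable => i _.
  apply: bigcup_measurable => j _.
  have mlt k : measurable [set p : W * R | dist k p.1 p.2 < r].
    rewrite -[X in measurable X]setTI; apply: measurable_fun_ltr => //.
    exact: measurable_bs_dist.
  exact: measurableI.
apply/seteqP; split => p /=; rewrite in_itv/= interferer_dist_lt.
  by case=> i [j [ij ir jr]]; exists i => //; exists j.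
by case=> i _ [j ij [ir jr]]; exists i, j.
Qed.

(** The squared distance in the orthonormal frame whose second axis points along
the velocity: the first coordinate is constant in time. *)
Lemma bs_dist_sqr i w t : dist i w t ^+ 2 =
  (sin (Theta i w) * (X i w).1 - cos (Theta i w) * (X i w).2) ^+ 2 +
  (cos (Theta i w) * (X i w).1 + sin (Theta i w) * (X i w).2 + v * t) ^+ 2.
Proof.
rewrite /bs_dist sqr_sqrtr ?addr_ge0 ?sqr_ge0//.
have := cos2Dsin2 (Theta i w); rewrite /bs_position /=.
set c := cos _; set s := sin _; set x := fst _; set y := snd _ => cs.
apply/eqP; rewrite -subr_eq0; apply/eqP.
transitivity ((1 - (c ^+ 2 + s ^+ 2)) * (x ^+ 2 + y ^+ 2 - (v * t) ^+ 2)).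
  by ring.
by rewrite cs subrr mul0r.
Qed.

Lemma closest_timeE i w : 0 < v -> closest_time v X Theta i w =
  - (cos (Theta i w) * (X i w).1 + sin (Theta i w) * (X i w).2) / v.
Proof.
move=> v0; rewrite /closest_time; set p := cos _ * _ + _.
have p0 : v * (- p / v) = - p by field; rewrite gt_eqF.
have dist_le s t :
    (dist i w s <= dist i w t) = ((p + v * s) ^+ 2 <= (p + v * t) ^+ 2).
  by rewrite -ler_sqr ?nnegrE ?bs_dist_ge0// !bs_dist_sqr lerD2l.
case: xgetP => [s _ /(_ (- p / v))|/(_ (- p / v)) []]; last first.
  by move=> t; rewrite dist_le p0 subrr expr0n sqr_ge0.
rewrite dist_le p0 subrr expr0n /= real_exprn_even_le0 ?num_real//=.
rewrite addr_eq0 => /eqP pE.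
by rewrite pE opprK; field; rewrite gt_eqF.
Qed.

Lemma measurable_closest_time i : 0 < v ->
  measurable_fun setT (closest_time v X Theta i).
Proof.
move=> v0; rewrite (_ : closest_time v X Theta i = fun w =>
  - (cos (Theta i w) * (X i w).1 + sin (Theta i w) * (X i w).2) / v);
  last by apply/funext => w; exact: closest_timeE.
have coord (c : W -> R) (f : R -> R) : continuous f -> measurable_fun setT c ->
    measurable_fun setT (fun w => f (Theta i w) * c w).
  move=> cf mc; apply: measurable_funM => //.
  exact: measurableT_comp (continuous_measurable_fun cf)
    (measurable_funPT (Theta i)).
apply: measurable_funM => //; apply: measurableT_comp => //.
apply: measurable_funD.
  apply: (coord _ cos); first exact: continuous_cos.
  exact: measurableT_comp measurable_fst (measurable_funPT (X i)).
apply: (coord _ sin); first exact: continuous_sin.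
exact: measurableT_comp measurable_snd (measurable_funPT (X i)).
Qed.

End Kinematics.

(** * Observation at an epoch as a normalised Campbell measure *)

Section Epochs.
Context {R : realType} {d : measure_display} {W : measurableType d}.
Context (P : probability W R).

Local Notation plane := (measurableTypeR R * measurableTypeR R)%type.

Variables (v : R) (X : nat -> {RV P >-> plane})
  (Theta : nat -> {RV P >-> measurableTypeR R}).
Hypothesis v_gt0 : 0 < v.

Lemma max_signal_epochsE : max_signal_epochs v X Theta =
  labelled_epochs (closest_time v X Theta)
    (fun i => [set w | is_nearest v X Theta i w (closest_time v X Theta i w)]).
Proof.
apply/funext => w; apply/seteqP.
by split => s [i [-> ?]]; exists i.
Qed.

Lemma measurable_nearest_at_closest_time i :
  measurable [set w | is_nearest v X Theta i w (closest_time v X Theta i w)].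
Proof.
have mdist j : measurable_fun setT
    (fun w => bs_dist v X Theta j w (closest_time v X Theta i w)).
  apply: (measurableT_comp (measurable_bs_dist P v X Theta j)
    (g := fun w => (w, closest_time v X Theta i w))).
  by apply: measurable_fun_pair => //; exact: measurable_closest_time.
rewrite (_ : [set w | _] = \bigcap_j [set w |
    bs_dist v X Theta i w (closest_time v X Theta i w) <=
    bs_dist v X Theta j w (closest_time v X Theta i w)]).
  apply: bigcap_measurable => // j _; rewrite -[X in measurable X]setTI.
  exact: measurable_fun_ler.
apply/seteqP; split => w /= near_i j; last exact: (near_i j I).
by move=> _; exact: near_i.
Qed.

(** At a fixed time [mu] is the image of [P], of mass 1; at max-signal epochs it
is the Campbell measure, whose mass is the intensity, so that in both cases the
expectation is the normalised integral. *)
Lemma expect0_campbell (e : epoch R) :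
  exists mu : {measure set (W * R) -> \bar R},
  (forall f : W * R -> \bar R,
     measurable_fun setT f -> (forall p, 0 <= f p)%E ->
     expect0 v X Theta e (fun w t => f (w, t)) =
     ((mu setT)^-1 * \int[mu]_p f p)%E) /\
  (forall N, measurable N -> P N = 0%E -> mu (N `*` setT) = 0%E).
Proof.
case: e => [t|].
  have mpair : measurable_fun setT (fun w : W => (w, t : R)).
    exact: measurable_fun_pair.
  exists (measure_function_pushforward__canonical__measure_function_Measure
    P mpair).
  split=> [f mf f0|N mN PN0]; last first.
    rewrite /= /pushforward -PN0; congr (P _).
    by apply/seteqP; split => [w [Nw _]|w Nw]; [exact: Nw|split].
  rewrite /= {1}/pushforward preimage_setT probability_setT inve1 mul1e.
  by rewrite ge0_integral_pushforward.
have [mu [muE mu0]] := campbell_measure_exists P _ _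
  (fun i => measurable_closest_time P v X Theta i v_gt0)
  measurable_nearest_at_closest_time.
exists mu; split => // f mf f0.
rewrite /= /palm_expectation /intensity max_signal_epochsE muE//.
congr (_^-1 * _)%E.
under eq_integral do rewrite counting_esum.
by rewrite (muE (cst 1%E))// integral_cst// mul1e.
Qed.

End Epochs.

(** * The coverage probability *)

Lemma inve_mulI (R : realType) (m a b : \bar R) : m != 0%E -> m != +oo%E ->
  (0 <= m)%E -> (m^-1 * a = m^-1 * b)%E -> a = b.
Proof.
case: m => [r| |]//; rewrite eqe => r0 _ _; rewrite inver (negbTE r0).
move=> /(congr1 (fun x => r%:E * x)%E); rewrite !muleA -!EFinM mulfV//.
by rewrite !mul1e.
Qed.

(** Positivity of [z] makes the denominator positive, and excludes that the
level is met through the truncation at 0. *)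
Lemma coverage_level (R : realType) (tau sigma y z : R) : 0 < tau -> 0 < z ->
  (tau <= y / (sigma ^+ 2 + z)) = (z <= Num.max 0 (y / tau - sigma ^+ 2)).
Proof.
move=> tau0 z0; have den0 : 0 < sigma ^+ 2 + z by rewrite ltr_wpDl ?sqr_ge0.
by rewrite ler_pdivlMr// le_max leNgt z0/= mulrC -ler_pdivlMr// lerBrDl.
Qed.

Lemma measure_eq_off_null d (T : measurableType d) (R : realType)
    (mu : {measure set T -> \bar R}) (A B N : set T) :
  measurable A -> measurable B -> measurable N -> mu N = 0%E ->
  (forall x, ~ N x -> A x <-> B x) -> mu A = mu B.
Proof.
move=> mA mB mN N0 AB.
have muD C : measurable C -> mu C = mu (C `\` N).
  move=> mC; transitivity (mu (C `\` N) + mu (C `&` N))%E.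
    exact: measureDI.
  rewrite (_ : mu (C `&` N) = 0%E) ?adde0//; apply/eqP.
  by rewrite -measure_le0 -N0 le_measure ?inE//; exact: measurableI.
rewrite (muD A)// (muD B)//; congr (mu _).
by apply/seteqP; split => x [Cx Nx]; split => //; exact/(AB x Nx).
Qed.

Theorem theorem4 (R : realType) (d : measure_display) (W : measurableType d)
    (P : probability W R) (lambda v tau alpha sigma : R)
    (X : nat -> {RV P >-> (measurableTypeR R * measurableTypeR R)%type})
    (Theta : nat -> {RV P >-> measurableTypeR R})
    (lambda_gt0 : 0 < lambda) (v_gt0 : 0 < v) (tau_gt0 : 0 < tau)
    (alpha_ge2 : 2 <= alpha) (sigma_ge0 : 0 <= sigma)
    (network : mobile_network lambda X Theta)
    (e : epoch R) (F : R -> cumulativeBounded (0 : R) (1 : R))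
    (F_cdf : conditional_cdf v X Theta e (serving_dist v X Theta)
               (tropical_interference v X Theta alpha) F) :
  coverage_probability v X Theta alpha sigma e tau =
  expect0 v X Theta e (fun w t =>
    let H := serving_dist v X Theta w t in
    (F H (Num.max 0 (H `^ (- alpha) / tau - sigma ^+ 2)))%:E).
Proof.
have [mu [muE mu_null]] := expect0_campbell P v X Theta v_gt0 e.
pose h (p : W * R) := serving_dist v X Theta p.1 p.2.
pose z (p : W * R) := tropical_interference v X Theta alpha p.1 p.2.
have mh : measurable_fun setT h by exact: measurable_serving_dist.
have mz : measurable_fun setT z.
  exact: measurableT_comp (measurable_powR (- alpha))
    (measurable_interferer_dist P v X Theta).
pose g (y : R) := Num.max 0 (y `^ (- alpha) / tau - sigma ^+ 2).
have g0 y : 0 <= g y by rewrite /g le_max lexx.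
have mg : measurable_fun setT g.
  apply: measurable_maxr => //; apply: measurable_funB => //.
  by apply: measurable_funM => //; exact: measurable_powR.
have F01 y x : 0 <= F y x by exact: cumulativeBounded01_ge0.
have mF x : measurable_fun setT (fun y : R => F y x) by have [] := F_cdf x.
pose covered := [set p : W * R | tau <= sinr v X Theta alpha sigma p.1 p.2].
have mcov : measurable covered.
  rewrite -[X in measurable X]setTI; apply: measurable_fun_ler => //.
  apply: measurable_funM.
    exact: measurableT_comp (measurable_powR (- alpha)) mh.
  (* The inverse is a power function on the nonnegative denominator. *)
  under eq_fun do rewrite -powR_inv1 ?addr_ge0 ?sqr_ge0 ?powR_ge0//.
  apply: measurableT_comp (measurable_powR (- 1)) _.
  by apply: measurable_funD.
have prob0E (A : set (W * R)) : measurable A ->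
    prob0 v X Theta e (fun w => [set t | A (w, t)]) = ((mu setT)^-1 * mu A)%E.
  move=> mA; rewrite /prob0.
  have -> : (fun w t => (\1_[set t' | A (w, t')] t)%:E) =
            (fun w t => (\1_A (w, t))%:E) :> (W -> R -> \bar R).
    by apply/funext => w; apply/funext => t; rewrite !indicE; congr (_%:R%:E).
  rewrite (muE (fun p => (\1_A p)%:E)).
  - by rewrite integral_indic// setIT.
  - by apply/measurable_EFinP; exact: measurable_indic.
  - by move=> p; rewrite lee_fin.
rewrite /coverage_probability (prob0E covered mcov).
have mFg : measurable_fun setT (fun p => (F (h p) (g (h p)))%:E : \bar R).
  apply/measurable_EFinP.
  exact: measurableT_comp (measurable_cdf_level F mF _ mg g0) mh.
rewrite (muE (fun p => (F (h p) (g (h p)))%:E))//; last first.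
  by move=> p; rewrite lee_fin.
(* Outside masses 0 and +oo the normalisation cancels. *)
have [muy|muy] := eqVneq (mu setT) +oo%E; first by rewrite muy invey !mul0e.
have [mu00|mun0] := eqVneq (mu setT) 0%E.
  rewrite null_set_integral//.
  have -> : mu covered = 0%E; last by [].
  by apply/eqP; rewrite -measure_le0 -mu00 le_measure// inE.
have mu_fin : (mu setT < +oo)%E by rewrite ltey.
have cancel a b : ((mu setT)^-1 * a = (mu setT)^-1 * b)%E -> a = b.
  exact: inve_mulI mun0 muy (measure_ge0 mu setT).
suff -> : mu covered = (\int[mu]_p (F (h p) (g (h p)))%:E)%E by [].
rewrite -(cdf_measurable_level F mF mu mu_fin h z mh mz _ g mg g0); last first.
  move=> x B mB; apply: cancel.
  have mBz : measurable [set p | B (h p) /\ z p <= x].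
    apply: measurableI.
      by rewrite -[X in measurable X]setTI; exact: mh.
    by rewrite -[X in measurable X]setTI; apply: measurable_fun_ler.
  rewrite -(prob0E _ mBz) -muE; last 2 first.
  - apply/measurable_EFinP; apply: measurable_funM.
      exact: measurableT_comp (measurable_indic mB) mh.
    exact: measurableT_comp (mF x) mh.
  - by move=> p; rewrite lee_fin mulr_ge0.
  exact: (F_cdf x).2.
have [N [mN PN0 good]] :
    {ae P, forall w, locally_finite P X w /\ avoids_origin P X Theta w}.
  have [Xpoisson _ _ marks] := network.
  apply: filterS2 (ae_locally_finite _ _ _ Xpoisson lambda_gt0)
    (ae_avoids_origin _ _ _ Xpoisson _ marks) => w; exact: conj.
apply: (measure_eq_off_null _ _ _ mu _ _ (N `*` setT)) => //.
- rewrite -[X in measurable X]setTI; apply: measurable_fun_ler => //.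
  exact: measurableT_comp mg mh.
- exact: measurableX.
- exact: mu_null.
move=> [w t] /= Nwt.
have [lf av] : locally_finite P X w /\ avoids_origin P X Theta w.
  by apply: contrapT => bad; apply: Nwt; split => //; exact: good.
rewrite /covered /= /sinr coverage_level//.
exact: powR_gt0 (interferer_dist_gt0 P v X Theta w t v_gt0 lf av).
Qed.
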